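(* Let $H$ be a hypergraph on $[n]$ with edge set $E$. A subset $X\subseteq E$ is dependent if and only if there is a cycle $C\subseteq X$.
   Context: $\mathbb{K}$ is a field of characteristic zero; edges of $H$ are nonempty subsets of $[n]$. A set of parameters of $H$ is $\{c_{i,e}\in\mathbb{K}\}$ with $c_{i,e}=0$ for $i\notin e$ and $\sum_i c_{i,e}=0$; edge $e$ then corresponds to the vector $(c_{1,e},\dots,c_{n,e})\in\mathbb{K}^n$. A set $F\subseteq E$ is independent if for some set of parameters the vectors of the edges in $F$ are linearly independent (equivalently, for a generic set of parameters); otherwise dependent. A subset $C\subseteq E$ is a cycle if $|C|=\left|\bigcup_{e\in C}e\right|$ and no proper nonempty subset $C'\subsetneq C$ satisfies $|C'|=\left|\bigcup_{e\in C'}e\right|$. *)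

(* Defs.v *)
From HB Require Import structures.
From mathcomp Require Import all_boot all_order all_algebra.

Set Implicit Arguments.
Unset Strict Implicit.
Unset Printing Implicit Defensive.

Import GRing.Theory.
Local Open Scope ring_scope.

Record hypergraph (n : nat) := Hypergraph {
  edges : {set {set 'I_n}};
  edges_nonempty : forall e : {set 'I_n}, e \in edges -> e != set0
}.

(* The values of c outside the edges of H are irrelevant. *)
Definition parameters (K : fieldType) (n : nat) (H : hypergraph n)
    (c : 'I_n -> {set 'I_n} -> K) : Prop :=
  forall e : {set 'I_n}, e \in edges H ->
    (forall i : 'I_n, i \notin e -> c i e = 0) /\ \sum_(i < n) c i e = 0.

Definition edge_vector (K : fieldType) (n : nat)
    (c : 'I_n -> {set 'I_n} -> K) (e : {set 'I_n}) : 'rV[K]_n :=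
  \row_(i < n) c i e.

(* Linear independence is that of the family indexed by the edges in F: two
   edges with the same vector make F fail the condition for that c. *)
Definition independent (K : fieldType) (n : nat) (H : hypergraph n)
    (F : {set {set 'I_n}}) : Prop :=
  exists2 c : 'I_n -> {set 'I_n} -> K,
    parameters H c & free [seq edge_vector c e | e <- enum F].

Definition dependent (K : fieldType) (n : nat) (H : hypergraph n)
    (F : {set {set 'I_n}}) : Prop :=
  ~ independent K H F.

(* The empty set satisfies the two numerical conditions vacuously, so it is
   excluded explicitly; cover C is the union of the edges in C. *)
Definition hcycle (n : nat) (H : hypergraph n) (C : {set {set 'I_n}}) : Prop :=
  [/\ C \subset edges H, C != set0, #|C| = #|cover C| &
      forall C' : {set {set 'I_n}},
        C' \proper C -> C' != set0 -> #|C'| <> #|cover C'|].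

(* Main.v *)
Require Import Defs.
From HB Require Import structures.
From mathcomp Require Import all_boot all_order all_algebra.

Set Implicit Arguments.
Unset Strict Implicit.
Unset Printing Implicit Defensive.

Import GRing.Theory.
Local Open Scope ring_scope.

(* The vectors of the edges of C lie in the sum-zero hyperplane of K^(cover C),
   so a cycle is dependent. Conversely, a nonempty C minimal with
   #|cover C| <= #|C| is a cycle; hence if X contains no cycle then
   #|C| < #|cover C| for every nonempty C in X. Hall's theorem then picks
   distinct representatives f e of the edges, and the strictness of the
   inequality lets one pick a second vertex g e of each edge so that the arcs
   f e -> g e form a forest oriented towards its roots. The vectors
   x_(f e) - x_(g e) of these arcs are linearly independent: among the arcs
   with nonzero coefficient in a relation, one starts at a leaf. *)

(** Induction on [#|J|], splitting on whether some nonempty proper subfamily is tight, i.e. has no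
    more values than members. A tight one is matched separately from the rest; if there is none, one
    index can be matched arbitrarily. *)
Lemma hall (T V : finType) (x0 : V) (A : T -> {set V}) (J : {set T}) :
  (forall C : {set T}, C \subset J -> #|C| <= #|\bigcup_(i in C) A i|)%N ->
  exists f : T -> V, {in J &, injective f} /\ {in J, forall i, f i \in A i}.
Proof.
have [m] := ubnP #|J|; elim: m => // m IH in A J * => /ltnSE leJm hallJ.
have [->|[e eJ]] := set_0Vmem J.
  by exists (fun=> x0); split=> [i j|i]; rewrite inE.
pose tight (C : {set T}) :=
  [&& C != set0, C \proper J & #|\bigcup_(i in C) A i| <= #|C|]%N.
have [D /and3P[D0 DJ tightD]|loose] := pickP tight.
  have sDJ := proper_sub DJ.
  have [f [f_inj fA]] : exists f : T -> V,
      {in D &, injective f} /\ {in D, forall i, f i \in A i}.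
    apply: IH => [|C sCD]; last exact: hallJ (subset_trans sCD sDJ).
    exact: leq_trans (proper_card DJ) leJm.
  set W := \bigcup_(i in D) A i in tightD.
  have [g [g_inj gA]] : exists g : T -> V, {in J :\: D &, injective g} /\
      {in J :\: D, forall i, g i \in A i :\: W}.
    apply: IH => [|C]; last rewrite subsetD => /andP[sCJ disCD].
      apply: leq_trans leJm; apply: proper_card.
      rewrite properE subsetDl; apply/negP => /subsetP sJD.
      case/set0Pn: D0 => d dD; have := sJD d (subsetP sDJ d dD).
      by rewrite inE dD.
    (* Hall's condition survives the removal of [W]: apply it to [C :|: D], then cancel [#|D|],
       which is at least [#|W|] by tightness. *)
    have: (#|C :|: D| <= #|W :|: \bigcup_(i in C) (A i :\: W)|)%N.
      have sCD : C :|: D \subset J by rewrite subUset sCJ.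
      apply: leq_trans (hallJ _ sCD) (subset_leq_card _).
      apply/bigcupsP => i; rewrite inE => /orP[iC|iD]; apply/subsetP => x xA.
        rewrite inE; case: (boolP (x \in W)) => //= xW.
        by apply/bigcupP; exists i; rewrite // inE xW.
      by rewrite inE; apply/orP; left; apply/bigcupP; exists i.
    rewrite cardsU (disjoint_setI0 disCD) cards0 subn0 addnC => leCD.
    rewrite -(leq_add2l #|D|); apply: leq_trans leCD _.
    rewrite cardsU; apply: leq_trans (leq_subr _ _) _.
    by rewrite leq_add2r.
  have fW i : i \in D -> f i \in W.
    by move=> iD; apply/bigcupP; exists i; rewrite ?fA.
  exists (fun i => if i \in D then f i else g i); split=> [i j iJ jJ|i iJ].
    have gW k : k \in J -> k \notin D -> g k \notin W.
      by move=> kJ kD; have := gA k; rewrite !inE kJ kD => /(_ isT) /andP[].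
    case: ifPn => iD; case: ifPn => jD //=; first exact: f_inj.
    - by move=> eq_fg; have := gW j jJ jD; rewrite -eq_fg fW.
    - by move=> eq_gf; have := gW i iJ iD; rewrite eq_gf fW.
    by apply: g_inj; rewrite inE ?iD ?jD.
  case: ifPn => iD; first exact: fA.
  by have := gA i; rewrite !inE iD iJ => /(_ isT) /andP[].
(* Every nonempty proper subfamily now has a value to spare, so [e] may take any [v] and the other
   indices can avoid it. *)
have [v vA] : exists v, v \in A e.
  have := hallJ [set e]; rewrite sub1set big_set1 cards1 => /(_ eJ).
  by move=> /card_gt0P.
have [f [f_inj fA]] : exists f : T -> V, {in J :\ e &, injective f} /\
    {in J :\ e, forall i, f i \in A i :\ v}.
  apply: IH => [|C sC].
    by apply: leq_trans leJm; rewrite [X in (_ < X)%N](cardsD1 e) eJ.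
  have [->|C0] := eqVneq C set0; first by rewrite cards0.
  have := loose C; rewrite /tight C0 (sub_proper_trans sC) ?properD1 //=.
  move/negbT; rewrite -ltnNge => ltC.
  rewrite -ltnS; apply: leq_trans ltC _.
  rewrite (cardsD1 v) -add1n leq_add ?leq_b1 //.
  apply: subset_leq_card; apply/subsetP => x.
  rewrite !inE => /andP[xv /bigcupP[i iC xA]].
  by apply/bigcupP; exists i; rewrite // !inE xv.
have fv i : i \in J -> i != e -> f i != v.
  by move=> iJ ie; have := fA i; rewrite !inE ie iJ => /(_ isT) /andP[].
exists (fun i => if i == e then v else f i); split=> [i j iJ jJ|i iJ].
  case: eqVneq => [->|ie]; case: eqVneq => [->|je] //.
  - by move=> eq_vf; have := fv j jJ je; rewrite -eq_vf eqxx.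
  - by move=> eq_fv; have := fv i iJ ie; rewrite eq_fv eqxx.
  by apply: f_inj; rewrite !inE ?ie ?je.
case: eqVneq => [->|ie] //.
by have := fA i; rewrite !inE ie iJ => /(_ isT) /andP[].
Qed.

(* Edges are peeled off: the first edge e0 gets g e0 outside f @: J, so g e0
   never spoils the witness found among the remaining edges. *)
Lemma acyclic_selection (T V : finType) (A : T -> {set V}) (f : T -> V)
    (J : {set T}) :
  (forall C : {set T}, C \subset J -> C != set0 ->
     exists2 e, e \in C & ~~ (A e \subset f @: C)) ->
  exists g : T -> V, {in J, forall e, g e \in A e} /\
    forall C : {set T}, C \subset J -> C != set0 ->
      exists2 e, e \in C & f e \notin g @: C.
Proof.
have [m] := ubnP #|J|; elim: m => // m IH in J * => /ltnSE leJm escJ.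
have [->|J0] := eqVneq J set0.
  exists f; split=> [e|C]; first by rewrite inE.
  by rewrite subset0 => ->.
have [e0 e0J /subsetPn[v vA vf]] := escJ J (subxx _) J0.
have [g [gA gC]] : exists g : T -> V, {in J :\ e0, forall e, g e \in A e} /\
    forall C : {set T}, C \subset J :\ e0 -> C != set0 ->
      exists2 e, e \in C & f e \notin g @: C.
  apply: IH => [|C sC]; last exact: escJ (subset_trans sC (subsetDl _ _)).
  by apply: leq_trans leJm; rewrite [X in (_ < X)%N](cardsD1 e0) e0J.
have fv e : e \in J -> f e != v.
  by move=> eJ; apply: contraNneq vf => <-; rewrite imset_f.
pose h e := if e == e0 then v else g e.
exists h; split=> [e eJ|C sCJ C0].
  by rewrite /h; case: eqVneq => [->|ee0] //; apply: gA; rewrite !inE ee0.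
have hC e (D : {set T}) : e \in J -> f e \notin g @: (D :\ e0) ->
    f e \notin h @: D.
  move=> eJ; apply: contra => /imsetP[e' e'D]; rewrite /h.
  case: eqVneq => [_ eq_fv|e'e0 ->]; first by have := fv e eJ; rewrite eq_fv eqxx.
  by rewrite imset_f // !inE e'e0.
have [D0|D0] := eqVneq (C :\ e0) set0.
  have [e eC] := set0Pn _ C0; exists e => //.
  by apply: hC; rewrite ?(subsetP sCJ) // D0 imset0 inE.
have [e eC fe] := gC _ (setSD _ sCJ) D0.
have /setD1P[_ eC'] := eC.
by exists e => //; apply: hC; rewrite ?(subsetP sCJ).
Qed.

Lemma free_enumP (K : fieldType) (vT : vectType K) (T : finType)
    (v : T -> vT) (F : {set T}) :
  free [seq v e | e <- enum F] <->
  forall a : T -> K, \sum_(e in F) a e *: v e = 0 -> {in F, forall e, a e = 0}.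
Proof.
have sumE (a : T -> K) : \sum_(e in F) a e *: v e =
    \sum_(i < #|F|) a (enum_val i) *: v (enum_val i).
  by rewrite big_enum_val.
pose s := [tuple v (enum_val i) | i < #|F|].
have sE : [seq v e | e <- enum F] = s.
  rewrite /= -[LHS](@mkseq_nth _ 0) size_map -cardE.
  rewrite /mkseq -val_enum_ord -map_comp; apply: eq_map => i /=.
  have e0 : T := enum_val i.
  by rewrite (nth_map e0) -?cardE // -enum_val_nth.
rewrite sE; split=> [/freeP freeF a a0 e eF|freeF].
  rewrite -(enum_rankK_in eF eF).
  apply: (freeF (fun i => a (enum_val i))); rewrite -{}[RHS]a0 sumE.
  by apply: eq_bigr => i _; rewrite -tnth_nth tnth_mktuple.
apply/freeP => k k0 i.
(* Coefficients indexed by positions in [enum F] are carried over to elements of [T], with default 0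
   outside [F]. *)
pose a e := if insub (index e (enum F)) is Some j then k j else 0.
have aE j : a (enum_val j) = k j.
  rewrite /a (enum_val_nth (enum_default j)) index_uniq ?enum_uniq -?cardE //.
  by rewrite valK.
rewrite -aE; apply: freeF (enum_valP i); rewrite sumE -[RHS]k0.
by apply: eq_bigr => j _; rewrite aE -tnth_nth tnth_mktuple.
Qed.

(** An inclusion-minimal nonempty [C] with [#|cover C| <= #|C|] is a cycle. If the inequality were
    strict, it would survive in weak form after deleting an edge, against minimality. *)
Lemma cycle_of_card_cover (n : nat) (H : hypergraph n) (X : {set {set 'I_n}}) :
  X \subset edges H -> X != set0 -> (#|cover X| <= #|X|)%N ->
  exists C : {set {set 'I_n}}, hcycle H C /\ C \subset X.
Proof.
move=> XE X0 leX.
pose P (C : {set {set 'I_n}}) := (C != set0) && (#|cover C| <= #|C|)%N.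
have [C /minsetP[/andP[C0 leC] minC] sCX] : {C | minset P C & C \subset X}.
  by apply: minset_exists; rewrite /P X0.
exists C; split=> //; have CE := subset_trans sCX XE.
split=> // [|D pDC D0 eqD]; last first.
  have /minC DC : P D by rewrite /P D0 eqD leqnn.
  by move: (pDC); rewrite DC ?proper_sub // properxx.
apply/eqP; rewrite eqn_leq leC andbT leqNgt; apply/negP => ltC.
have [e eC] := set0Pn _ C0.
have cardC := cardsD1 e C; rewrite eC add1n in cardC.
(* When [C] is the single edge [e], the deletion leaves nothing; strictness would then make [e]
   empty, which hypergraphs exclude. *)
have [D0|D0] := eqVneq (C :\ e) set0.
  move: ltC; rewrite cardC D0 cards0 ltnS leqn0 cards_eq0 => /eqP coverC0.
  have := edges_nonempty (subsetP CE e eC).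
  by rewrite -subset0 -coverC0 (bigcup_sup e).
have /minC/(_ (subsetDl _ _)) eqC : P (C :\ e).
  rewrite /P D0 -ltnS -cardC; apply: leq_trans ltC; rewrite ltnS.
  apply: subset_leq_card; apply/bigcupsP => i /setD1P[_ iC].
  exact: bigcup_sup iC.
by move: cardC; rewrite {1}eqC => /n_Sn.
Qed.

Lemma independent_of_card_cover (K : fieldType) (n : nat) (H : hypergraph n)
    (X : {set {set 'I_n}}) :
  (forall C : {set {set 'I_n}}, C \subset X -> C != set0 ->
     #|C| < #|cover C|)%N ->
  independent K H X.
Proof.
move=> wide.
(* [hall] needs a default vertex, and [n] may be 0; a nonempty [X] provides one. *)
have [->|/set0Pn[e0 e0X]] := eqVneq X set0.
  exists (fun _ _ => 0); last by rewrite enum_set0 nil_free.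
  by move=> e _; split=> //; rewrite big1.
have [x0 _] : exists x0 : 'I_n, true.
  have := wide [set e0]; rewrite sub1set => /(_ e0X).
  rewrite -card_gt0 cards1 => /(_ isT) /ltnW /card_gt0P[x _].
  by exists x.
have [f [f_inj fe]] : exists f : {set 'I_n} -> 'I_n,
    {in X &, injective f} /\ {in X, forall e, f e \in e}.
  apply: (hall x0 (A := id)) => C sCX.
  have [->|C0] := eqVneq C set0; first by rewrite cards0.
  exact: ltnW (wide C sCX C0).
(* [f @: C] has only [#|C|] elements, too few to contain [cover C], so some edge of [C] sticks out
   of it. *)
have [|g [ge gC]] := @acyclic_selection _ _ id f X.
  move=> C sCX C0; case: (pickP [pred e in C | ~~ (e \subset f @: C)]) => /=.
    by move=> e /andP[eC ef]; exists e.
  move=> esc; have := wide C sCX C0; rewrite ltnNge.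
  have <- : #|f @: C| = #|C|.
    by apply: card_in_imset; apply: sub_in2 f_inj; apply/subsetP.
  move=> /negP[].
  apply: subset_leq_card; apply/bigcupsP => e eC.
  by have := esc e; rewrite /= eC => /negbFE.
(* Since [f e] and [g e] both lie in [e], the vector of the arc is supported on [e] and has sum
   zero. *)
pose c (i : 'I_n) (e : {set 'I_n}) : K :=
  if e \in X then (i == f e)%:R - (i == g e)%:R else 0.
exists c.
  move=> e _; rewrite /c; split=> [i ie|].
    case: ifP => // eX; have := fe e eX; have := ge e eX.
    case: eqVneq => [<-|_]; first by rewrite (negbTE ie).
    by case: eqVneq => [<-|_]; rewrite ?(negbTE ie) ?subrr.
  case: (e \in X); last by rewrite big1.
  have sum_delta v : \sum_i (i == v)%:R = 1 :> K.
    rewrite (bigD1 v) //= eqxx big1 ?addr0 // => i iv.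
    by rewrite (negbTE iv).
  by rewrite sumrB !sum_delta subrr.
apply/free_enumP => a a0 e eX; apply/eqP; apply: contraT => ae.
pose C := [set e in X | a e != 0].
have sCX : C \subset X by apply/subsetP => e'; rewrite inE => /andP[].
have [|e' e'C fe'] := gC C sCX.
  by apply/set0Pn; exists e; rewrite inE eX.
move: (e'C); rewrite inE => /andP[e'X /eqP[]].
(* Read the relation at coordinate [f e']. No [g d] with [d] in [C] equals it, and no other [f d]
   does by injectivity, so only [a e'] remains. *)
have /rowP/(_ (f e')) := a0; rewrite summxE mxE (bigD1 e') //=.
rewrite big1 => [|d /andP[dX de']]; rewrite !mxE /c.
  rewrite e'X eqxx addr0; case: eqVneq => [eq_fg|_].
    by move: fe'; rewrite eq_fg imset_f.
  by rewrite subr0 mulr1.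
have [->|ad] := eqVneq (a d) 0; first by rewrite mul0r.
have dC : d \in C by rewrite inE dX.
rewrite dX; case: eqVneq => [eq_f|_].
  by rewrite (f_inj _ _ e'X dX eq_f) eqxx in de'.
case: eqVneq => [eq_fg|_]; last by rewrite subrr mulr0.
by move: fe'; rewrite eq_fg imset_f.
Qed.

(** For a fixed [r] in [cover C], the [#|cover C| - 1] differences of basis vectors x_i - x_r, with
    [i] another vertex of [cover C], span all the edge vectors of [C]. *)
Lemma card_lt_cover_of_free (K : fieldType) (n : nat) (H : hypergraph n)
    (c : 'I_n -> {set 'I_n} -> K) (C : {set {set 'I_n}}) :
  parameters H c -> C \subset edges H -> C != set0 ->
  free [seq edge_vector c e | e <- enum C] -> (#|C| < #|cover C|)%N.
Proof.
move=> cH CE C0 freeC.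
have [e0 e0C] := set0Pn _ C0.
have [r re0] := set0Pn _ (edges_nonempty (subsetP CE e0 e0C)).
have rC : r \in cover C by apply/bigcupP; exists e0.
pose s := [seq delta_mx 0 i - delta_mx 0 r : 'rV[K]_n | i <- enum (cover C :\ r)].
have sub_s : (<<[seq edge_vector c e | e <- enum C]>> <= <<s>>)%VS.
  apply/span_subvP => _ /mapP[e + ->]; rewrite mem_enum => eC.
  have [c0 sum_c] := cH e (subsetP CE e eC).
  (* The x_r terms add up to zero because the coordinates of the edge vector do. *)
  have -> : edge_vector c e = \sum_i c i e *: (delta_mx 0 i - delta_mx 0 r).
    under eq_bigr do rewrite scalerBr.
    rewrite sumrB -scaler_suml sum_c scale0r subr0 {1}[LHS]row_sum_delta.
    by apply: eq_bigr => i _; rewrite mxE.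
  apply: memv_suml => i _.
  have [ie|ie] := boolP (i \in e); last by rewrite c0 // scale0r mem0v.
  have [->|ir] := eqVneq i r; first by rewrite subrr scaler0 mem0v.
  apply/memvZ/memv_span/map_f; rewrite mem_enum !inE ir.
  by apply/bigcupP; exists e.
rewrite (cardsD1 r (cover C)) rC add1n ltnS [X in (X <= _)%N]cardE.
rewrite -(size_map (edge_vector c)) -(eqP freeC) [X in (_ <= X)%N]cardE.
apply: leq_trans (dimvS sub_s) _; apply: leq_trans (dim_span _) _.
by rewrite size_map.
Qed.

Theorem mainTheorem8 (K : fieldType) (charK : [pchar K] =i pred0)
    (n : nat) (H : hypergraph n) (X : {set {set 'I_n}})
    (XE : X \subset edges H) :
  dependent K H X <->
  exists C : {set {set 'I_n}}, hcycle H C /\ C \subset X.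
Proof.
split=> [depX|[C [[CE C0 eqC _] sCX]] [c cH /free_enumP freeX]].
  pose big (C : {set {set 'I_n}}) :=
    [&& C \subset X, C != set0 & #|cover C| <= #|C|]%N.
  have [D /and3P[sDX D0 leD]|wide] := pickP big.
    have [C [CH sCD]] := cycle_of_card_cover (subset_trans sDX XE) D0 leD.
    by exists C; split=> //; apply: subset_trans sDX.
  case: depX; apply: independent_of_card_cover => C sCX C0.
  by have := wide C; rewrite /big sCX C0 ltnNge => /negbT.
have := @card_lt_cover_of_free K n H c C cH CE C0; rewrite eqC ltnn => absurd.
apply/notF/absurd/free_enumP => a a0 e eC.
(* A relation on [C] extended by zero is a relation on [X], so freeness passes from [X] to [C]. *)
have := freeX (fun e => if e \in C then a e else 0) _ e (subsetP sCX e eC).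
rewrite eC; apply; rewrite -[RHS]a0 (big_setID C) /= (setIidPr sCX).
rewrite [X in _ + X]big1 ?addr0 => [|d /setDP[_ /negbTE->]]; last first.
  by rewrite scale0r.
by apply: eq_bigr => d ->.
Qed.
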